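(* Let $K$ be the decorated combinatorial pentagonal tiling defined in the context. Then: (1) The set of collared tiles of $K$ (i.e. collared types of tiles of $K$) is exactly the following set of 36 tuples: 1. $(4,3,0\mid 5,4,1\mid 2,1,0\mid 2,1,2\mid 4,3,0)$; 2. $(4,3,0\mid 5,4,1\mid 2,1,0\mid 3,2,3\mid 4,3,0)$; 3. $(4,3,0\mid 5,4,1\mid 2,1,2\mid 3,2,3\mid 4,3,0)$; 4. $(4,3,0\mid 5,4,5\mid 1,5,0\mid 2,1,2\mid 4,3,0)$; 5. $(4,3,0\mid 5,4,5\mid 1,5,1\mid 2,1,2\mid 4,3,0)$; 6. $(4,3,0\mid 5,4,5\mid 1,5,1\mid 3,2,3\mid 4,3,0)$; 7. $(4,3,0\mid 5,4,5\mid 1,5,2\mid 3,2,3\mid 4,3,0)$; 8. $(4,3,0\mid 5,4,5\mid 2,1,0\mid 2,1,0\mid 3,2,3)$; 9. $(4,3,4\mid 1,5,0\mid 1,5,0\mid 2,1,2\mid 3,2,0)$; 10. $(4,3,4\mid 1,5,0\mid 1,5,0\mid 2,1,2\mid 3,2,3)$; 11. $(4,3,4\mid 1,5,0\mid 1,5,0\mid 2,1,3\mid 4,3,0)$; 12. $(4,3,4\mid 1,5,1\mid 2,1,0\mid 2,1,0\mid 3,2,3)$; 13. $(4,3,4\mid 5,4,0\mid 1,5,1\mid 3,2,0\mid 3,2,0)$; 14. $(4,3,4\mid 5,4,1\mid 2,1,2\mid 3,2,0\mid 3,2,0)$; 15. $(4,3,4\mid 5,4,5\mid 1,5,1\mid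 3,2,0\mid 3,2,0)$; 16. $(4,3,4\mid 5,4,5\mid 2,1,0\mid 2,1,0\mid 3,2,3)$; 17. $(4,3,4\mid 5,4,5\mid 2,1,2\mid 3,2,0\mid 3,2,0)$; 18. $(4,3,5\mid 1,5,0\mid 1,5,1\mid 3,2,0\mid 3,2,0)$; 19. $(4,3,5\mid 1,5,0\mid 2,1,2\mid 3,2,0\mid 3,2,0)$; 20. $(4,3,5\mid 1,5,1\mid 2,1,0\mid 2,1,0\mid 3,2,3)$; 21. $(4,3,5\mid 1,5,1\mid 2,1,2\mid 3,2,0\mid 3,2,0)$; 22. $(5,4,0\mid 1,5,0\mid 2,1,0\mid 3,2,0\mid 4,3,0)$; 23. $(5,4,0\mid 1,5,1\mid 2,1,0\mid 2,1,0\mid 3,2,4)$; 24. $(5,4,0\mid 5,4,0\mid 1,5,1\mid 2,1,0\mid 3,2,3)$; 25. $(5,4,0\mid 5,4,0\mid 1,5,1\mid 2,1,2\mid 3,2,3)$; 26. $(5,4,0\mid 5,4,0\mid 1,5,1\mid 2,1,2\mid 4,3,4)$; 27. $(5,4,0\mid 5,4,0\mid 1,5,1\mid 2,1,3\mid 4,3,4)$; 28. $(5,4,0\mid 5,4,0\mid 1,5,2\mid 3,2,0\mid 3,2,3)$; 29. $(5,4,0\mid 5,4,0\mid 1,5,2\mid 3,2,0\mid 4,3,4)$; 30. $(5,4,0\mid 5,4,0\mid 1,5,2\mid 3,2,3\mid 4,3,4)$; 31. $(5,4,0\mid 5,4,5\mid 2,1,0\mid 2,1,0\mid 3,2,4)$;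 32. $(5,4,5\mid 1,5,0\mid 1,5,0\mid 2,1,2\mid 3,2,3)$; 33. $(5,4,5\mid 1,5,0\mid 1,5,0\mid 2,1,2\mid 3,2,4)$; 34. $(5,4,5\mid 1,5,0\mid 1,5,0\mid 2,1,3\mid 4,3,0)$; 35. $(5,4,5\mid 1,5,0\mid 1,5,0\mid 2,1,3\mid 4,3,4)$; 36. $(5,4,5\mid 1,5,1\mid 2,1,0\mid 2,1,0\mid 3,2,4)$. (2) The set of collared edges of $K$ (up to the identification $(a,b,c,d\mid e,f,g,h)\sim(e,f,g,h\mid a,b,c,d)$) is exactly the following set of 45 tuples: 1. $(1,0,2,4\mid 3,4,1,2)$; 2. $(1,0,2,4\mid 3,4,5,2)$; 3. $(1,0,2,4\mid 3,5,1,2)$; 4. $(1,0,3,4\mid 3,0,5,2)$; 5. $(1,0,3,4\mid 3,4,1,2)$; 6. $(1,0,3,5\mid 4,0,1,2)$; 7. $(1,0,3,5\mid 4,5,1,2)$; 8. $(1,2,3,4\mid 3,0,5,2)$; 9. $(1,2,3,4\mid 3,4,1,2)$; 10. $(1,2,3,4\mid 3,4,5,2)$; 11. $(1,2,3,4\mid 3,5,1,2)$; 12. $(1,2,3,5\mid 4,0,5,2)$; 13. $(1,2,3,5\mid 4,5,1,2)$; 14. $(1,2,4,5\mid 4,0,1,2)$; 15. $(1,2,4,5\mid 4,0,5,2)$; 16. $(1,2,4,5\mid 4,5,1,2)$; 17. $(1,3,4,5\mid 4,0,5,2)$; 18. $(1,3,4,5\mid 4,5,1,2)$; 19. $(2,0,3,5\mid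 4,1,2,3)$; 20. $(2,0,3,5\mid 4,5,1,3)$; 21. $(2,0,3,5\mid 4,5,2,3)$; 22. $(2,0,4,1\mid 5,0,2,3)$; 23. $(2,0,4,1\mid 5,1,2,3)$; 24. $(2,0,4,5\mid 4,0,1,3)$; 25. $(2,0,4,5\mid 4,5,2,3)$; 26. $(2,3,4,1\mid 5,0,1,3)$; 27. $(2,3,4,1\mid 5,1,2,3)$; 28. $(2,3,4,5\mid 4,0,1,3)$; 29. $(2,3,4,5\mid 4,1,2,3)$; 30. $(2,3,4,5\mid 4,5,1,3)$; 31. $(2,3,4,5\mid 4,5,2,3)$; 32. $(2,3,5,1\mid 5,0,1,3)$; 33. $(2,3,5,1\mid 5,0,2,3)$; 34. $(2,3,5,1\mid 5,1,2,3)$; 35. $(2,4,5,1\mid 5,0,1,3)$; 36. $(2,4,5,1\mid 5,1,2,3)$; 37. $(3,0,4,1\mid 5,1,2,4)$; 38. $(3,0,4,1\mid 5,1,3,4)$; 39. $(3,0,4,1\mid 5,2,3,4)$; 40. $(3,0,5,1\mid 5,0,2,4)$; 41. $(3,0,5,1\mid 5,1,3,4)$; 42. $(3,4,5,1\mid 5,0,2,4)$; 43. $(3,4,5,1\mid 5,1,2,4)$; 44. $(3,4,5,1\mid 5,1,3,4)$; 45. $(3,4,5,1\mid 5,2,3,4)$. (3) The set of collared vertices of $K$ is exactly the following set of 10 tuples: 1. $(1,0,2,4)$; 2. $(1,0,3,4)$; 3. $(1,0,3,5)$; 4. $(1,2,3,4)$; 5. $(1,2,3,5)$; 6. $(1,2,4,5)$;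 7. $(1,3,4,5)$; 8. $(2,0,3,5)$; 9. $(2,0,4,5)$; 10. $(2,3,4,5)$.
   Context: Labels are taken in $\{1,2,3,4,5\}$ and read modulo 5. A decorated pentagon is an oriented combinatorial pentagon whose five vertices are labelled $1,2,3,4,5$ consecutively in clockwise order (its decoration). Each tile has its own labels, so a vertex shared by several tiles carries one label from each of them. Decorated subdivision $\omega$: let $t$ be a decorated pentagon with vertices $v_1,\dots,v_5$, $v_i$ having label $i$. Let $m_i$ be a new vertex in the middle of the edge $v_iv_{i+1}$, add an interior pentagon with vertices $c_1,\dots,c_5$ (clockwise) and an edge $c_im_i$ for each $i$. So $t$ is subdivided into six pentagons, labelled as follows: in the central one $c_i$ has label $i$; in the corner pentagon at $v_i$ the vertices $v_i,m_i,c_i,c_{i-1},m_{i-1}$ (in clockwise order) have labels $i,i+1,i+2,i+3,i+4$. Applied to every tile, this defines $\omega$ on complexes of decorated pentagons. The tiling $K$: let $K_0$ be a single decorated pentagon and $K_n=\omega^n(K_0)$. Identify $K_0$, label-preservingly, with the central pentagon of $K_1=\omega(K_0)$; applying $\omega^n$ gives inclusions $K_n\subset K_{n+1}$, and $K=\bigcup_n K_n$. It is a tiling of the plane by decorated pentagons; all its vertices have degree 3 or 4. Collared tile: for a tile $t$ of $K$ with vertices $v_1,\dots,v_5$ ($v_i$ with label $i$ in $t$), let $N_i$ be the neighbour of $t$ across the edge $v_iv_{i+1}$. The collared type of $t$ is the tuple of five blocks $(p_1,q_1,r_1\mid\dots\mid p_5,q_5,r_5)$, where $p_i$ is the label in $N_i$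 of $v_i$, $q_i$ is the label in $N_i$ of $v_{i+1}$, and $r_i$ is $0$ if $v_{i+1}$ has degree 3, while if $v_{i+1}$ has degree 4, $r_i$ is the label of $v_{i+1}$ in the fourth tile at $v_{i+1}$, i.e. the one different from $t,N_i,N_{i+1}$. The collared tiles of $K$ are the tuples so obtained. Collared vertex: for a vertex $v$ of $K$, the labels of $v$ in the tiles containing it, read clockwise around $v$; this is a cyclic sequence, written starting from its smallest entry as $(a,b,c,d)$ if $v$ has degree 4 and, if $v$ has degree 3 with labels $a,c,d$, as $(a,0,c,d)$. Collared edge: let $e$ be an edge of $K$ with endpoints $v,w$, and $A,B$ its two adjacent tiles, where $A$ has label $i$ at $v$ and $i+1$ at $w$, and $B$ has label $j$ at $w$ and $j+1$ at $v$. The collared edge is $(i,i',i'',j+1\mid j,j',j'',i+1)$, where $(i,i',i'',j+1)$ are the labels of $v$ in the tiles around $v$ read clockwise starting at $A$, and $(j,j',j'',i+1)$ are the labels of $w$ in the tiles around $w$ read clockwise starting at $B$; if the endpoint has degree 3, the second entry of the corresponding quadruple is set to $0$ and the third entry is the label in the unique remaining tile. Exchanging the roles of $A$ and $B$ gives the identification $(a,b,c,d\mid e,f,g,h)\sim(e,f,g,h\mid a,b,c,d)$. *)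

(* Defs.v *)
From HB Require Import structures.
From mathcomp Require Import all_boot all_algebra.
From mathcomp Require Import boolp classical_sets functions cardinality.
From mathcomp Require Import generic_quotient.

Set Implicit Arguments.
Unset Strict Implicit.
Unset Printing Implicit Defensive.

Import GRing.Theory.

Local Open Scope ring_scope.
Local Open Scope quotient_scope.
Local Open Scope classical_set_scope.
Local Open Scope card_scope.

(* Labels are residues modulo 5; the residue 0 is the label 5, so that written
   tuples, where 0 is a separate symbol, use the representative in 1, ..., 5. *)
Notation label := 'Z_5.

Definition num (i : label) : nat := if i == 0 then 5%N else nat_of_ord i.

(* A complex of decorated pentagons: [vert t i] is the vertex with label [i] in
   the tile [t], and [side t i] is the edge of [t] from [vert t i] to
   [vert t (i + 1)]; labels increase clockwise around each tile. The cells of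
   the complex are the tiles and the vertices and edges of tiles; other elements
   of the types [vertex] and [edge] (for instance a [half_edge e v] below with
   [v] not on [e]) are never seen by the notions defined in this file. *)
Record complex := Complex {
  vertex : Type;
  edge : Type;
  tile : Type;
  vert : tile -> label -> vertex;
  side : tile -> label -> edge }.

Arguments vert {c} _ _.
Arguments side {c} _ _.

Record hom (X Y : complex) := Hom {
  hom_vertex : vertex X -> vertex Y;
  hom_edge : edge X -> edge Y;
  hom_tile : tile X -> tile Y;
  hom_vert : forall t i, hom_vertex (vert t i) = vert (hom_tile t) i;
  hom_side : forall t i, hom_edge (side t i) = side (hom_tile t) i }.

Definition pentagon : complex :=
  @Complex label label unit (fun _ i => i) (fun _ i => i).

(* The family indexed by the labels i, i+1, i+2, i+3, i+4 in this order. *)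
Definition from (T : Type) (i : label) (x0 x1 x2 x3 x4 : T) (j : label) : T :=
  nth x0 [:: x0; x1; x2; x3; x4] (nat_of_ord (j - i)).

Section Subdivision.
Variable X : complex.

Variant sub_vertex : Type :=
  | old_vertex of vertex X
  | midpoint of edge X
  | inner_vertex of tile X & label.     (* c_i *)

Variant sub_edge : Type :=
  | half_edge of edge X & vertex X      (* from an endpoint to the midpoint *)
  | spoke of tile X & label             (* c_i m_i *)
  | ring_edge of tile X & label.        (* c_i c_{i+1} *)

Variant sub_tile : Type :=
  | center of tile X
  | corner of tile X & label.

Definition sub_vert (s : sub_tile) : label -> sub_vertex :=
  match s with
  | center t => inner_vertex t
  | corner t i =>
      from i (old_vertex (vert t i)) (midpoint (side t i)) (inner_vertex t i)
             (inner_vertex t (i - 1)) (midpoint (side t (i - 1)))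
  end.

Definition sub_side (s : sub_tile) : label -> sub_edge :=
  match s with
  | center t => ring_edge t
  | corner t i =>
      from i (half_edge (side t i) (vert t i)) (spoke t i)
             (ring_edge t (i - 1)) (spoke t (i - 1))
             (half_edge (side t (i - 1)) (vert t i))
  end.

Definition omega : complex := Complex sub_vert sub_side.

End Subdivision.

Arguments old_vertex {X} _.
Arguments midpoint {X} _.
Arguments inner_vertex {X} _ _.
Arguments half_edge {X} _ _.
Arguments spoke {X} _ _.
Arguments ring_edge {X} _ _.
Arguments center {X} _.
Arguments corner {X} _ _.

Section SubdivisionHom.
Variables (X Y : complex) (h : hom X Y).

Definition omega_vertex (v : vertex (omega X)) : vertex (omega Y) :=
  match v with
  | old_vertex v => old_vertex (hom_vertex h v)
  | midpoint e => midpoint (hom_edge h e)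
  | inner_vertex t i => inner_vertex (hom_tile h t) i
  end.

Definition omega_edge (e : edge (omega X)) : edge (omega Y) :=
  match e with
  | half_edge e v => half_edge (hom_edge h e) (hom_vertex h v)
  | spoke t i => spoke (hom_tile h t) i
  | ring_edge t i => ring_edge (hom_tile h t) i
  end.

Definition omega_tile (s : tile (omega X)) : tile (omega Y) :=
  match s with
  | center t => center (hom_tile h t)
  | corner t i => corner (hom_tile h t) i
  end.

Lemma map_from (T U : Type) (f : T -> U) i x0 x1 x2 x3 x4 j :
  f (from i x0 x1 x2 x3 x4 j) =
  from i (f x0) (f x1) (f x2) (f x3) (f x4) j.
Proof. by rewrite /from; case: (j - i)=> [[|[|[|[|[|]]]]]]. Qed.

Lemma omega_vertP s i : omega_vertex (vert s i) = vert (omega_tile s) i.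
Proof.
by case: s => [t|t k] //; rewrite [LHS]map_from /= !(hom_vert h) !(hom_side h).
Qed.

Lemma omega_sideP s i : omega_edge (side s i) = side (omega_tile s) i.
Proof.
by case: s => [t|t k] //; rewrite [LHS]map_from /= !(hom_vert h) !(hom_side h).
Qed.

Definition omega_hom : hom (omega X) (omega Y) := Hom omega_vertP omega_sideP.

End SubdivisionHom.

Definition central_hom (X : complex) (t : tile X) : hom pentagon (omega X) :=
  @Hom pentagon (omega X) (inner_vertex t) (ring_edge t) (fun _ => center t)
    (fun _ _ => erefl) (fun _ _ => erefl).

Fixpoint Kn (n : nat) : complex :=
  if n is n'.+1 then omega (Kn n') else pentagon.

Fixpoint Kn_incl (n : nat) : hom (Kn n) (Kn n.+1) :=
  if n is n'.+1 then omega_hom (Kn_incl n') else @central_hom pentagon tt.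

(* The union of a sequence of types along maps from each one to the next: its
   elements are the pairs (n, x) with x in the n-th type, two of them being
   identified when they have a common image at some later stage. *)
Section Union.
Variables (F : nat -> Type) (f : forall n, F n -> F n.+1).

Definition stage : Type := {classic {n : nat & F n}}.

Definition next_stage (p : stage) : stage :=
  existT F (projT1 p).+1 (f (projT2 p)).

Definition eventually_eq (p q : stage) : bool :=
  `[< exists k l : nat, iter k next_stage p = iter l next_stage q >].

Lemma eventually_eq_refl : reflexive eventually_eq.
Proof. by move=> p; apply/asboolP; exists 0%N, 0%N. Qed.

Lemma eventually_eq_sym : symmetric eventually_eq.
Proof.
by move=> p q; apply/asboolP/asboolP => -[k [l e]]; exists l, k; rewrite e.
Qed.

Lemma eventually_eq_trans : transitive eventually_eq.
Proof.
move=> q p r /asboolP[k [l e]] /asboolP[k' [l' e']]; apply/asboolP.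
by exists (k' + k)%N, (l + l')%N; rewrite !iterD e -e' -!iterD addnC.
Qed.

Canonical eventually_eq_equiv :=
  EquivRel eventually_eq eventually_eq_refl eventually_eq_sym
    eventually_eq_trans.

Definition union : Type := {eq_quot eventually_eq}.

Definition union_in (n : nat) (x : F n) : union :=
  \pi_{eq_quot eventually_eq} (existT F n x : stage).

Lemma union_in_next n (x : F n) : union_in (f x) = union_in x.
Proof. by apply/eqmodP/asboolP; exists 0%N, 1%N. Qed.

End Union.

Section UnionMap.
Variables (F G : nat -> Type) (f : forall n, F n -> F n.+1).
Variables (g : forall n, G n -> G n.+1) (u : forall n, F n -> G n).
Arguments u {n} _.

Definition union_map (x : union f) : union g :=
  union_in g (u (projT2 (repr x))).

Lemma union_map_in (uf : forall n (x : F n), u (f x) = g (u x)) n (x : F n) :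
  union_map (union_in f x) = union_in g (u x).
Proof.
rewrite /union_map; set p := repr _.
have : \pi_{eq_quot eventually_eq f} p = union_in f x by rewrite reprK.
move=> /eqmodP/asboolP[k [l e]]; apply/eqmodP/asboolP; exists k, l.
pose w (p : stage F) : stage G := existT G (projT1 p) (u (projT2 p)).
have wN m q : iter m (next_stage g) (w q) = w (iter m (next_stage f) q).
  by elim: m => //= m ->; rewrite /w /next_stage /= uf.
by rewrite -[existT _ _ (u x)]/(w (existT F n x)) -[LHS]/(iter k _ (w p)) !wN e.
Qed.

End UnionMap.

Definition K : complex :=
  @Complex (union (fun n => hom_vertex (Kn_incl n)))
           (union (fun n => hom_edge (Kn_incl n)))
           (union (fun n => hom_tile (Kn_incl n)))
           (fun t i => union_map _ (fun n s => vert s i) t)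
           (fun t i => union_map _ (fun n s => side s i) t).

Lemma K_vert n (t : tile (Kn n)) i :
  @vert K (union_in _ t) i = union_in _ (vert t i).
Proof. by apply: union_map_in => m s; rewrite hom_vert. Qed.

Lemma K_side n (t : tile (Kn n)) i :
  @side K (union_in _ t) i = union_in _ (side t i).
Proof. by apply: union_map_in => m s; rewrite hom_side. Qed.

Definition Kn_hom n : hom (Kn n) K :=
  Hom (fun t i => esym (K_vert t i)) (fun t i => esym (K_side t i)).

Section Collared.
Variable X : complex.
Implicit Types (v w : vertex X) (e : edge X) (t u A B : tile X) (i j : label).

Definition incident e v : Prop :=
  exists t i, side t i = e /\ (vert t i = v \/ vert t (i + 1) = v).

Definition degree v (d : nat) : Prop := [set e | incident e v] #= `I_d.

Definition neighbour t i u : Prop := u <> t /\ exists j, side u j = side t i.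

(* [c] lists, as pairs (tile, label of v in it), the tiles containing [v] in
   clockwise order around [v]. As labels increase clockwise around each tile,
   the tile [u] that follows [t] clockwise around the vertex with label [i] in
   [t] is the one across the edge from label [i - 1] to label [i] in [t]; if
   that vertex has label [j] in [u], this edge goes from [j] to [j + 1] in
   [u]. *)
Definition clockwise_around v (d : nat) (c : 'I_d -> tile X * label) : Prop :=
  [/\ injective c,
      forall t i, vert t i = v <-> exists k, c k = (t, i)
    & forall k, (c (ordS k)).1 <> (c k).1 /\
        side (c (ordS k)).1 (c (ordS k)).2 = side (c k).1 ((c k).2 - 1)].

Definition quad : Type := (nat * nat * nat * nat)%type.

Definition quad_from v A (q : quad) : Prop :=
  (degree v 4 /\ exists c : 'I_4 -> tile X * label,
     let l k := num (c (inord k)).2 in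
     [/\ clockwise_around v c, (c ord0).1 = A
       & q = (l 0%N, l 1%N, l 2%N, l 3%N)]) \/
  (degree v 3 /\ exists c : 'I_3 -> tile X * label,
     let l k := num (c (inord k)).2 in
     [/\ clockwise_around v c, (c ord0).1 = A
       & q = (l 0%N, 0%N, l 1%N, l 2%N)]).

Definition smallest_first (q : quad) : bool :=
  let: (a, b, c, d) := q in
  [&& (b == 0%N) || (a <= b)%N, (a <= c)%N & (a <= d)%N].

Definition collared_vertex v (q : quad) : Prop :=
  smallest_first q /\ exists A, quad_from v A q.

Definition collared_edge e (q : quad * quad) : Prop :=
  exists A B i j v w,
    [/\ A <> B, side A i = e & side B j = e] /\
    [/\ vert A i = v, vert A (i + 1) = w, vert B j = w & vert B (j + 1) = v] /\
    quad_from v A q.1 /\ quad_from w B q.2.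

Definition block : Type := (nat * nat * nat)%type.

Definition collared_block t (N : label -> tile X) i (b : block) : Prop :=
  let: (p, q, r) := b in
  [/\ exists2 j, vert (N i) j = vert t i & p = num j,
      exists2 j, vert (N i) j = vert t (i + 1) & q = num j
    & (degree (vert t (i + 1)) 3 /\ r = 0%N) \/
      (degree (vert t (i + 1)) 4 /\
       exists u j, [/\ u <> t, u <> N i, u <> N (i + 1),
                       vert u j = vert t (i + 1) & r = num j])].

(* The k-th entry of the tuple (k = 0, ..., 4) is the block of label k + 1. *)
Definition collared_tile t (b : 5.-tuple block) : Prop :=
  exists N : label -> tile X,
    (forall i, neighbour t i (N i)) /\
    forall k : 'I_5, collared_block t N k.+1%:R (tnth b k).

End Collared.

Definition edge_equiv (q q' : quad * quad) : bool :=
  (q == q') || (q == (q'.2, q'.1)).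

Definition collared_tiles : seq (5.-tuple block) :=
  [::
   [tuple (4, 3, 0); (5, 4, 1); (2, 1, 0); (2, 1, 2); (4, 3, 0)];
   [tuple (4, 3, 0); (5, 4, 1); (2, 1, 0); (3, 2, 3); (4, 3, 0)];
   [tuple (4, 3, 0); (5, 4, 1); (2, 1, 2); (3, 2, 3); (4, 3, 0)];
   [tuple (4, 3, 0); (5, 4, 5); (1, 5, 0); (2, 1, 2); (4, 3, 0)];
   [tuple (4, 3, 0); (5, 4, 5); (1, 5, 1); (2, 1, 2); (4, 3, 0)];
   [tuple (4, 3, 0); (5, 4, 5); (1, 5, 1); (3, 2, 3); (4, 3, 0)];
   [tuple (4, 3, 0); (5, 4, 5); (1, 5, 2); (3, 2, 3); (4, 3, 0)];
   [tuple (4, 3, 0); (5, 4, 5); (2, 1, 0); (2, 1, 0); (3, 2, 3)];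
   [tuple (4, 3, 4); (1, 5, 0); (1, 5, 0); (2, 1, 2); (3, 2, 0)];
   [tuple (4, 3, 4); (1, 5, 0); (1, 5, 0); (2, 1, 2); (3, 2, 3)];
   [tuple (4, 3, 4); (1, 5, 0); (1, 5, 0); (2, 1, 3); (4, 3, 0)];
   [tuple (4, 3, 4); (1, 5, 1); (2, 1, 0); (2, 1, 0); (3, 2, 3)];
   [tuple (4, 3, 4); (5, 4, 0); (1, 5, 1); (3, 2, 0); (3, 2, 0)];
   [tuple (4, 3, 4); (5, 4, 1); (2, 1, 2); (3, 2, 0); (3, 2, 0)];
   [tuple (4, 3, 4); (5, 4, 5); (1, 5, 1); (3, 2, 0); (3, 2, 0)];
   [tuple (4, 3, 4); (5, 4, 5); (2, 1, 0); (2, 1, 0); (3, 2, 3)];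
   [tuple (4, 3, 4); (5, 4, 5); (2, 1, 2); (3, 2, 0); (3, 2, 0)];
   [tuple (4, 3, 5); (1, 5, 0); (1, 5, 1); (3, 2, 0); (3, 2, 0)];
   [tuple (4, 3, 5); (1, 5, 0); (2, 1, 2); (3, 2, 0); (3, 2, 0)];
   [tuple (4, 3, 5); (1, 5, 1); (2, 1, 0); (2, 1, 0); (3, 2, 3)];
   [tuple (4, 3, 5); (1, 5, 1); (2, 1, 2); (3, 2, 0); (3, 2, 0)];
   [tuple (5, 4, 0); (1, 5, 0); (2, 1, 0); (3, 2, 0); (4, 3, 0)];
   [tuple (5, 4, 0); (1, 5, 1); (2, 1, 0); (2, 1, 0); (3, 2, 4)];
   [tuple (5, 4, 0); (5, 4, 0); (1, 5, 1); (2, 1, 0); (3, 2, 3)];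
   [tuple (5, 4, 0); (5, 4, 0); (1, 5, 1); (2, 1, 2); (3, 2, 3)];
   [tuple (5, 4, 0); (5, 4, 0); (1, 5, 1); (2, 1, 2); (4, 3, 4)];
   [tuple (5, 4, 0); (5, 4, 0); (1, 5, 1); (2, 1, 3); (4, 3, 4)];
   [tuple (5, 4, 0); (5, 4, 0); (1, 5, 2); (3, 2, 0); (3, 2, 3)];
   [tuple (5, 4, 0); (5, 4, 0); (1, 5, 2); (3, 2, 0); (4, 3, 4)];
   [tuple (5, 4, 0); (5, 4, 0); (1, 5, 2); (3, 2, 3); (4, 3, 4)];
   [tuple (5, 4, 0); (5, 4, 5); (2, 1, 0); (2, 1, 0); (3, 2, 4)];
   [tuple (5, 4, 5); (1, 5, 0); (1, 5, 0); (2, 1, 2); (3, 2, 3)];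
   [tuple (5, 4, 5); (1, 5, 0); (1, 5, 0); (2, 1, 2); (3, 2, 4)];
   [tuple (5, 4, 5); (1, 5, 0); (1, 5, 0); (2, 1, 3); (4, 3, 0)];
   [tuple (5, 4, 5); (1, 5, 0); (1, 5, 0); (2, 1, 3); (4, 3, 4)];
   [tuple (5, 4, 5); (1, 5, 1); (2, 1, 0); (2, 1, 0); (3, 2, 4)]
  ]%N.

Definition collared_edges : seq (quad * quad) :=
  [::
   ((1, 0, 2, 4), (3, 4, 1, 2));
   ((1, 0, 2, 4), (3, 4, 5, 2));
   ((1, 0, 2, 4), (3, 5, 1, 2));
   ((1, 0, 3, 4), (3, 0, 5, 2));
   ((1, 0, 3, 4), (3, 4, 1, 2));
   ((1, 0, 3, 5), (4, 0, 1, 2));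
   ((1, 0, 3, 5), (4, 5, 1, 2));
   ((1, 2, 3, 4), (3, 0, 5, 2));
   ((1, 2, 3, 4), (3, 4, 1, 2));
   ((1, 2, 3, 4), (3, 4, 5, 2));
   ((1, 2, 3, 4), (3, 5, 1, 2));
   ((1, 2, 3, 5), (4, 0, 5, 2));
   ((1, 2, 3, 5), (4, 5, 1, 2));
   ((1, 2, 4, 5), (4, 0, 1, 2));
   ((1, 2, 4, 5), (4, 0, 5, 2));
   ((1, 2, 4, 5), (4, 5, 1, 2));
   ((1, 3, 4, 5), (4, 0, 5, 2));
   ((1, 3, 4, 5), (4, 5, 1, 2));
   ((2, 0, 3, 5), (4, 1, 2, 3));
   ((2, 0, 3, 5), (4, 5, 1, 3));
   ((2, 0, 3, 5), (4, 5, 2, 3));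
   ((2, 0, 4, 1), (5, 0, 2, 3));
   ((2, 0, 4, 1), (5, 1, 2, 3));
   ((2, 0, 4, 5), (4, 0, 1, 3));
   ((2, 0, 4, 5), (4, 5, 2, 3));
   ((2, 3, 4, 1), (5, 0, 1, 3));
   ((2, 3, 4, 1), (5, 1, 2, 3));
   ((2, 3, 4, 5), (4, 0, 1, 3));
   ((2, 3, 4, 5), (4, 1, 2, 3));
   ((2, 3, 4, 5), (4, 5, 1, 3));
   ((2, 3, 4, 5), (4, 5, 2, 3));
   ((2, 3, 5, 1), (5, 0, 1, 3));
   ((2, 3, 5, 1), (5, 0, 2, 3));
   ((2, 3, 5, 1), (5, 1, 2, 3));
   ((2, 4, 5, 1), (5, 0, 1, 3));
   ((2, 4, 5, 1), (5, 1, 2, 3));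
   ((3, 0, 4, 1), (5, 1, 2, 4));
   ((3, 0, 4, 1), (5, 1, 3, 4));
   ((3, 0, 4, 1), (5, 2, 3, 4));
   ((3, 0, 5, 1), (5, 0, 2, 4));
   ((3, 0, 5, 1), (5, 1, 3, 4));
   ((3, 4, 5, 1), (5, 0, 2, 4));
   ((3, 4, 5, 1), (5, 1, 2, 4));
   ((3, 4, 5, 1), (5, 1, 3, 4));
   ((3, 4, 5, 1), (5, 2, 3, 4))
  ]%N.

Definition collared_vertices : seq quad :=
  [::
   (1, 0, 2, 4);
   (1, 0, 3, 4);
   (1, 0, 3, 5);
   (1, 2, 3, 4);
   (1, 2, 3, 5);
   (1, 2, 4, 5);
   (1, 3, 4, 5);
   (2, 0, 3, 5);
   (2, 0, 4, 5);
   (2, 3, 4, 5)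
  ]%N.

Lemma collared_edges_inequivalent :
  pairwise (fun q q' => ~~ edge_equiv q q') collared_edges.
Proof. by []. Qed.

(* Main.v *)
Require Import Defs.
From mathcomp Require Import all_boot all_algebra.
From mathcomp Require Import boolp classical_sets functions cardinality.
From mathcomp Require Import generic_quotient.

Set Implicit Arguments.
Unset Strict Implicit.
Unset Printing Implicit Defensive.

Import Defs.
Import GRing.Theory.

Local Open Scope ring_scope.
Local Open Scope quotient_scope.

(** The tiling [K] reproduces itself: the inclusions [Kn n -> omega (Kn n)] have
    as their union a map [desubdivide : K -> omega K], injective on vertices
    and edges and bijective on tiles. It exhibits every tile of [K] as the
    center or as a corner of the subdivision of a tile of [K], its parent, and
    from any tile of [K] the chain of parents reaches a center
    ([K_tile_ind]). A local property of [K] thus follows as soon as centers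
    have it and corners inherit it from their parents. This first shows that
    every edge of [K] separates two distinct tiles, traversed in opposite
    directions ([K_opposite]).

    What has to be inherited for the theorem is the code of a tile, the list
    of the five cyclic sequences of labels around its vertices, each of them
    read clockwise from the tile itself. In the subdivision of a tile [t]:
    - a new vertex inside [t] has degree 3 and labels that depend only on its
      number;
    - the midpoint of an edge has degree 4, and its labels depend only on the
      numbers [i] and [j] of this edge in its two tiles; moreover, [j] can be
      read off the code of [t], being the second label around [vert t (i + 1)];
    - an old vertex keeps its labels.
    The code of a corner is therefore a function [corner_code] of the code of
    its parent ([corner_tile_code]), whereas all centers have the same code
    ([center_tile_code]). Hence the codes that occur in [K] are exactly those
    obtained from [center_code] by iterating [corner_code]: this closure has
    36 elements and is reached after three rounds ([codes_closed],
    [codes_K]).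

    Finally all three kinds of collared objects are read off the codes. The
    fourth tile at a vertex is the third one of its cyclic sequence; and the
    sequence around [vert t (i + 1)] read from the tile across the edge [i] is
    the one read from [t] rotated by one step ([link_rot]), so that a collared
    edge consists of two consecutive entries of a code. The three
    lists of the theorem then come out of a finite computation. *)

(** * Labels modulo 5 *)

(** Case analysis on the position of [k] relative to [i]; the five offsets are
    written 0, 1, 2, -2, -1 because the subdivision treats the two sides of
    the corner [i] symmetrically. *)
Lemma label_ind (i : label) (P : label -> Prop) :
  P i -> P (i + 1) -> P (i + 2) -> P (i - 2) -> P (i - 1) -> forall k, P k.
Proof.
move=> P0 P1 P2 P3 P4 k; rewrite -[k](subrK i) addrC.
case: (k - i) => [[|[|[|[|[|//]]]]] lt_r].
- by rewrite (_ : Ordinal lt_r = 0) ?addr0 //; apply: val_inj.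
- by rewrite (_ : Ordinal lt_r = 1) //; apply: val_inj.
- by rewrite (_ : Ordinal lt_r = 2) //; apply: val_inj.
- by rewrite (_ : Ordinal lt_r = - 2) //; apply: val_inj.
- by rewrite (_ : Ordinal lt_r = - 1) //; apply: val_inj.
Qed.

Arguments label_ind i P : clear implicits.

Lemma label_add1S (i : label) : i + 1 + 1 = i + 2.
Proof. by rewrite -addrA. Qed.

Lemma label_sub2S (i : label) : i - 2 + 1 = i - 1.
Proof. by rewrite -addrA; congr (i + _); apply: val_inj. Qed.

Lemma label_sub1P (i : label) : i - 1 - 1 = i - 2.
Proof. by rewrite -addrA; congr (i + _); apply: val_inj. Qed.

Lemma label_add2P (i : label) : i + 2 - 1 = i + 1.
Proof. by rewrite -addrA; congr (i + _); apply: val_inj. Qed.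

Lemma label_add1P (i : label) : i + 1 - 2 = i - 1.
Proof. by rewrite -addrA; congr (i + _); apply: val_inj. Qed.

Lemma label_add1A2 (i : label) : i + 1 + 2 = i - 2.
Proof. by rewrite -addrA; congr (i + _); apply: val_inj. Qed.

Lemma label_sub1P2 (i : label) : i - 1 - 2 = i + 2.
Proof. by rewrite -addrA; congr (i + _); apply: val_inj. Qed.

Lemma label_sub1A2 (i : label) : i - 1 + 2 = i + 1.
Proof. by rewrite -addrA; congr (i + _); apply: val_inj. Qed.

Lemma label_neqS (i : label) : i + 1 <> i.
Proof. by rewrite -[RHS]addr0 => /addrI. Qed.

Lemma label_neqP (i : label) : i - 1 <> i.
Proof. by rewrite -[RHS]addr0 => /addrI. Qed.

(* The entries 3 and 4 of [from] are at the offsets -2 and -1. *)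
Section From.
Variables (T : Type) (i : label) (x0 x1 x2 x3 x4 : T).
Local Notation f := (from i x0 x1 x2 x3 x4).

Lemma from0 : f i = x0. Proof. by rewrite /from subrr. Qed.
Lemma from1 : f (i + 1) = x1. Proof. by rewrite /from addrAC subrr add0r. Qed.
Lemma from2 : f (i + 2) = x2. Proof. by rewrite /from addrAC subrr add0r. Qed.
Lemma from3 : f (i - 2) = x3. Proof. by rewrite /from addrAC subrr add0r. Qed.
Lemma from4 : f (i - 1) = x4. Proof. by rewrite /from addrAC subrr add0r. Qed.

Definition fromE := (from0, from1, from2, from3, from4).
End From.

(** * Darts and cyclic sequences around a vertex *)

Section Darts.
Variable X : complex.
Implicit Types (t u : tile X) (i j : label) (s : seq label).

(** The two darts, or pairs of a tile and a label, that lie on the same edge,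
    which they traverse in opposite directions; the last clause excludes a
    third tile on this edge and thus makes [(u, j)] a function of [(t, i)]. *)
Definition opposite t i u j : Prop :=
  [/\ u <> t, side u j = side t i,
      vert u j = vert t (i + 1) /\ vert u (j + 1) = vert t i
    & forall t' i', side t' i' = side t i ->
        (t', i') = (t, i) \/ (t', i') = (u, j)].

(** The step of [clockwise_around]. *)
Definition next_around t i u j : Prop := u <> t /\ side u j = side t (i - 1).

(** The combinatorial link of [vert t i], as the sequence of the labels of this
    vertex in the tiles around it, clockwise from [t]. Only the degrees 3 and 4
    of the vertices of [K] are considered. *)
Definition link t i s : Prop :=
  exists n (c : 'I_n.+1 -> tile X * label),
    [/\ n = 2%N \/ n = 3%N, clockwise_around (vert t i) c, c ord0 = (t, i)
      & s = mkseq (fun k => (c (inord k)).2) n.+1].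

Lemma link3 t0 i0 t1 i1 t2 i2 :
    next_around t0 i0 t1 i1 -> next_around t1 i1 t2 i2 ->
    next_around t2 i2 t0 i0 ->
    (forall t i, vert t i = vert t0 i0 <->
       [\/ (t, i) = (t0, i0), (t, i) = (t1, i1) | (t, i) = (t2, i2)]) ->
  link t0 i0 [:: i0; i1; i2].
Proof.
move=> [n01 e01] [n12 e12] [n20 e20] all_v; exists 2%N.
exists (fun k : 'I_3 => nth (t0, i0) [:: (t0, i0); (t1, i1); (t2, i2)] k).
split=> //; [by left| |by rewrite /mkseq /= !inordK]; split.
- by move=> [[|[|[|k]]] ltk] [[|[|[|l]]] ltl] //= eq_c;
    first [exact: val_inj | case: eq_c => *; exfalso; congruence].
- move=> t i; rewrite all_v; split=> [|[[[|[|[|k]]] ltk] //= <-]].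
  + by case=> ->; [exists 0|exists 1|exists (inord 2)]; rewrite ?inordK.
  + exact: Or31.
  + exact: Or32.
  + exact: Or33.
- by move=> [[|[|[|k]]] ltk] //=.
Qed.

Lemma link4 t0 i0 t1 i1 t2 i2 t3 i3 :
    next_around t0 i0 t1 i1 -> next_around t1 i1 t2 i2 ->
    next_around t2 i2 t3 i3 -> next_around t3 i3 t0 i0 ->
    t0 <> t2 -> t1 <> t3 ->
    (forall t i, vert t i = vert t0 i0 <->
       [\/ (t, i) = (t0, i0), (t, i) = (t1, i1), (t, i) = (t2, i2)
         | (t, i) = (t3, i3)]) ->
  link t0 i0 [:: i0; i1; i2; i3].
Proof.
move=> [n01 e01] [n12 e12] [n23 e23] [n30 e30] n02 n13 all_v; exists 3%N.
exists (fun k : 'I_4 =>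
  nth (t0, i0) [:: (t0, i0); (t1, i1); (t2, i2); (t3, i3)] k).
split=> //; [by right| |by rewrite /mkseq /= !inordK]; split.
- by move=> [[|[|[|[|k]]]] ltk] [[|[|[|[|l]]]] ltl] //= eq_c;
    first [exact: val_inj | case: eq_c => *; exfalso; congruence].
- move=> t i; rewrite all_v; split=> [|[[[|[|[|[|k]]]] ltk] //= <-]].
  + by case=> ->; [exists 0|exists 1|exists (inord 2)|exists (inord 3)];
      rewrite ?inordK.
  + exact: Or41.
  + exact: Or42.
  + exact: Or43.
  + exact: Or44.
- by move=> [[|[|[|[|k]]]] ltk] //=.
Qed.

End Darts.

(** A tile touches itself neither at a vertex nor along an edge. *)
Definition injective_tiles (X : complex) : Prop :=
  forall t : tile X, injective (vert t) /\ injective (side t).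

Section OppositeSymmetry.
Variable X : complex.
Implicit Types (t u : tile X) (i j : label).

Lemma opposite_sym t i u j : opposite t i u j -> opposite u j t i.
Proof.
move=> [ne_ut e_ut [v1 v2] e_darts]; split=> // [/esym //|t' i'].
by rewrite e_ut => /e_darts[]; [right|left].
Qed.

End OppositeSymmetry.

(** * Local structure of a subdivision *)

Section Omega.
Variable X : complex.
Implicit Types (t u : tile X) (i j : label) (s : seq label).

Lemma corner_vertE t i :
  let v := @vert (omega X) (corner t i) in
  ((v i = old_vertex (vert t i)) * (v (i + 1)%R = midpoint (side t i)) *
   (v (i + 2)%R = inner_vertex t i) * (v (i - 2)%R = inner_vertex t (i - 1)%R) *
   (v (i - 1)%R = midpoint (side t (i - 1)%R)))%type.
Proof. by rewrite /= !fromE. Qed.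

Lemma corner_sideE t i :
  let e := @side (omega X) (corner t i) in
  ((e i = half_edge (side t i) (vert t i)) * (e (i + 1)%R = spoke t i) *
   (e (i + 2)%R = ring_edge t (i - 1)%R) * (e (i - 2)%R = spoke t (i - 1)%R) *
   (e (i - 1)%R = half_edge (side t (i - 1)%R) (vert t i)))%type.
Proof. by rewrite /= !fromE. Qed.

(** The corners [i] and [i + 1] meet along the spoke [i], between the inner
    vertex [i] and the midpoint of the edge [i]: here the cells near this spoke
    are seen from the corner [i + 1]. *)
Lemma next_corner_sideE t i :
  let e := @side (omega X) (corner t (i + 1)) in
  ((e i = half_edge (side t i) (vert t (i + 1)%R)) * (e (i - 1)%R = spoke t i) *
   (e (i - 2)%R = ring_edge t i))%type.
Proof.
have:= corner_sideE t (i + 1); rewrite /= label_add1A2 label_add1P addrK.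
by move=> H; rewrite !H.
Qed.

Lemma next_corner_vertE t i :
  let v := @vert (omega X) (corner t (i + 1)) in
  ((v i = midpoint (side t i)) * (v (i - 1)%R = inner_vertex t i))%type.
Proof.
have:= corner_vertE t (i + 1); rewrite /= label_add1P addrK.
by move=> H; rewrite !H.
Qed.

Lemma inner_darts t i (s : tile (omega X)) k :
  vert s k = inner_vertex t i <->
  [\/ (s, k) = (center t, i), (s, k) = (corner t i, i + 2)
    | (s, k) = (corner t (i + 1), i - 1)].
Proof.
split=> [|[[-> ->]|[-> ->]|[-> ->]]];
  rewrite ?corner_vertE ?next_corner_vertE //.
case: s => [u [-> ->]|u j]; first exact: Or31.
elim/(label_ind j): k; rewrite corner_vertE // => -[-> <-]; first exact: Or32.
by apply: Or33; rewrite subrK label_sub1P.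
Qed.

(** A dart at a midpoint belongs to the corner at one end of a dart of the
    edge, and [opposite] leaves two darts with two ends each. *)
Lemma midpoint_darts t i u j : opposite t i u j ->
  forall (s : tile (omega X)) k, vert s k = midpoint (side t i) <->
  [\/ (s, k) = (corner t i, i + 1), (s, k) = (corner u (j + 1), j),
      (s, k) = (corner u j, j + 1) | (s, k) = (corner t (i + 1), i)].
Proof.
move=> [_ e _ e_darts] s k.
split=> [|[[-> ->]|[-> ->]|[-> ->]|[-> ->]]];
  rewrite ?corner_vertE ?next_corner_vertE ?e //.
case: s => [//|t' i']; elim/(label_ind i'): k; rewrite corner_vertE //.
  by case=> /e_darts[] [-> ->]; [exact: Or41|exact: Or43].
rewrite -[X in corner _ X](subrK 1); move: (i' - 1) => k [] /e_darts[] [-> ->].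
  exact: Or44.
exact: Or42.
Qed.

Lemma center_link t i : @link (omega X) (center t) i [:: i; i + 2; i - 1].
Proof.
apply: (@link3 (omega X) (center t) i (corner t i) _ (corner t (i + 1))).
- by split; rewrite ?corner_sideE.
- split; last by rewrite label_add2P corner_sideE next_corner_sideE.
  by case=> /label_neqS.
- split=> //; rewrite label_sub1P next_corner_sideE //.
- exact: inner_darts.
Qed.

Lemma inner_link t i :
  @link (omega X) (corner t i) (i + 2) [:: i + 2; i - 1; i].
Proof.
apply: (@link3 (omega X) _ _ (corner t (i + 1)) _ (center t)).
- split; last by rewrite label_add2P corner_sideE next_corner_sideE.
  by case=> /label_neqS.
- by split=> //; rewrite label_sub1P next_corner_sideE.
- by split; rewrite ?corner_sideE.
- move=> s k; rewrite corner_vertE inner_darts.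
  by split=> -[]; [exact: Or33|exact: Or31|exact: Or32
                  |exact: Or32|exact: Or33|exact: Or31].
Qed.

Lemma next_inner_link t i :
  @link (omega X) (corner t (i + 1)) (i - 1) [:: i - 1; i; i + 2].
Proof.
apply: (@link3 (omega X) _ _ (center t) _ (corner t i)).
- by split=> //; rewrite label_sub1P next_corner_sideE.
- by split; rewrite ?corner_sideE.
- split; last by rewrite label_add2P corner_sideE next_corner_sideE.
  by case=> /label_neqS.
- move=> s k; rewrite next_corner_vertE inner_darts.
  by split=> -[]; [exact: Or32|exact: Or33|exact: Or31
                  |exact: Or33|exact: Or31|exact: Or32].
Qed.

Lemma midpoint_around t i u j : opposite t i u j ->
  next_around (X := omega X) (corner t i) (i + 1) (corner u (j + 1)) j /\
  next_around (X := omega X) (corner t (i + 1)) i (corner t i) (i + 1).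
Proof.
move=> [ne_ut e_ut [_ v_ut] _]; split; split.
- by case=> /ne_ut.
- by rewrite addrK corner_sideE next_corner_sideE e_ut v_ut.
- by case=> /esym/label_neqS.
- by rewrite corner_sideE next_corner_sideE.
Qed.

Lemma midpoint_link t i u j : opposite t i u j ->
  @link (omega X) (corner t i) (i + 1) [:: i + 1; j; j + 1; i] /\
  @link (omega X) (corner t (i + 1)) i [:: i; i + 1; j; j + 1].
Proof.
move=> opp_tu; have opp_ut := opposite_sym opp_tu.
have ne_ut : u <> t by case: opp_tu.
have [a1 a2] := midpoint_around opp_tu; have [b1 b2] := midpoint_around opp_ut.
have all_v := midpoint_darts opp_tu; split.
  apply: (@link4 (omega X) _ _ (corner u (j + 1)) _ (corner u j) _
            (corner t (i + 1))) => //; try by case.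
    by case=> /esym.
  by move=> s k; rewrite corner_vertE all_v.
apply: (@link4 (omega X) _ _ (corner t i) _ (corner u (j + 1)) _
          (corner u j)) => //; try by case=> /esym.
move=> s k; rewrite next_corner_vertE all_v.
by split=> -[]; [exact: Or42|exact: Or43|exact: Or44|exact: Or41
                |exact: Or44|exact: Or41|exact: Or42|exact: Or43].
Qed.

(** Around an old vertex, every tile is replaced by its corner, and every edge
    by the half of it that ends at this vertex. *)
Lemma old_link t i s : link t i s -> @link (omega X) (corner t i) i s.
Proof.
move=> [n [c [n23 [inj_c all_v adj_c] c0 s_c]]]; exists n.
exists (fun k => (corner (c k).1 (c k).2, (c k).2)).
split=> //; last by rewrite c0.
rewrite corner_vertE; split.
- move=> k l [e1 _ e2]; apply: inj_c.
  by rewrite [LHS]surjective_pairing e1 e2 -surjective_pairing.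
- case=> [t'|t' j] k; first by split=> [|[]].
  split=> [|[l [<- <- <-]]].
    elim/(label_ind j): k; rewrite corner_vertE // => -[/all_v[l c_l]].
    by exists l; rewrite c_l.
  rewrite corner_vertE; congr old_vertex.
  by apply/all_v; exists l; case: (c l).
- move=> k; have [ne_c e_c] := adj_c k; split=> [[/ne_c]//|].
  rewrite !corner_sideE e_c; congr half_edge.
  by transitivity (vert t i); [|apply/esym]; apply/all_v;
    [exists (ordS k)|exists k]; case: (c _).
Qed.

Lemma ring_opposite t i :
  @opposite (omega X) (center t) i (corner t (i + 1)) (i - 2).
Proof.
split=> //; first by rewrite next_corner_sideE.
  by split; [rewrite -label_add1A2 corner_vertE
            |rewrite label_sub2S next_corner_vertE].
move=> [u k [-> ->]|u j k]; first by left.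
elim/(label_ind j): k; rewrite corner_sideE //.
by case=> -> <-; right; rewrite subrK -label_add1A2 subrK.
Qed.

Lemma spoke_opposite t i :
  @opposite (omega X) (corner t i) (i + 1) (corner t (i + 1)) (i - 1).
Proof.
split.
- by case=> /label_neqS.
- by rewrite corner_sideE next_corner_sideE.
- by rewrite label_add1S subrK !corner_vertE !next_corner_vertE.
rewrite corner_sideE => -[//|u j] k.
elim/(label_ind j): k; rewrite corner_sideE // => -[-> <-].
  by left.
by right; rewrite subrK label_sub1P.
Qed.

(** Both halves of an edge lie in the corners of its two tiles. Injectivity
    distinguishes the two halves by their ends. *)
Lemma half_opposite t i u j : injective_tiles X -> opposite t i u j ->
  @opposite (omega X) (corner t i) i (corner u (j + 1)) j.
Proof.
move=> inj_X [ne_ut e_ut [v1 v2] e_darts]; split.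
- by case=> /ne_ut.
- by rewrite corner_sideE next_corner_sideE e_ut v2.
- by rewrite !corner_vertE next_corner_vertE e_ut v2.
have neq_v t' i' : vert t' (i' + 1) <> vert t' i'.
  by have [inj_v _] := inj_X t'; move=> /inj_v/label_neqS.
rewrite corner_sideE => -[//|t' i'] k.
elim/(label_ind i'): k; rewrite corner_sideE //.
  case=> /e_darts[] [-> ->]; first by left.
  by rewrite v1 => /neq_v.
rewrite -[X in corner _ X](subrK 1) -[X in vert _ X](subrK 1).
move: (i' - 1) => k [] /e_darts[] [-> ->]; first by move=> /neq_v.
by right.
Qed.

(** The last two sides of the corner [i + 1] lie on the spoke [i] and on the
    edge [i] of [t], whence their indices here. *)
Lemma corner_ind (P : forall s : tile (omega X), label -> Prop) t :
    (forall i, P (corner t i) i) -> (forall i, P (corner t i) (i + 1)) ->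
    (forall i, P (corner t i) (i + 2)) ->
    (forall i, P (corner t (i + 1)) (i - 1)) ->
    (forall i, P (corner t (i + 1)) i) -> forall i k, P (corner t i) k.
Proof.
move=> P0 P1 P2 P3 P4 i k; elim/(label_ind i): k => //.
  by rewrite -label_sub1P -[X in corner _ X](subrK 1).
by rewrite -[X in corner _ X](subrK 1).
Qed.

Lemma omega_opposite : injective_tiles X -> forall t,
  (forall i, exists u j, opposite t i u j) ->
  forall i k, exists (a : tile (omega X)) j,
    @opposite (omega X) (corner t i) k a j.
Proof.
move=> inj_X t opp_t.
apply: (@corner_ind (fun a k =>
  exists (b : tile (omega X)) j, opposite a k b j)) => i;
  have [u [j opp_i]] := opp_t i.
- by exists (corner u (j + 1)), j; apply: half_opposite.
- by exists (corner t (i + 1)), (i - 1); apply: spoke_opposite.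
- exists (center t), (i - 1); apply/opposite_sym.
  by have:= ring_opposite t (i - 1); rewrite subrK label_sub1P2.
- by exists (corner t i), (i + 1); apply/opposite_sym/spoke_opposite.
- exists (corner u j), j; apply/opposite_sym/half_opposite => //.
  exact: opposite_sym.
Qed.

Lemma omega_injective_tiles : injective_tiles X -> injective_tiles (omega X).
Proof.
move=> inj_X [t|t i]; first by split=> k l [].
have [_ inj_e] := inj_X t.
have ne_e : side t i <> side t (i - 1) by move/inj_e/esym/label_neqP.
have ne_i : i <> i - 1 by move/esym/label_neqP.
by split=> k l; elim/(label_ind i): k; elim/(label_ind i): l;
  rewrite ?corner_vertE ?corner_sideE // => -[] *; exfalso; congruence.
Qed.

End Omega.
(** * Transport along injective maps *)

Definition injective_hom X Y (h : hom X Y) : Prop :=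
  [/\ injective (hom_vertex h), injective (hom_edge h)
    & injective (hom_tile h)].

Section Transport.
Variables (X Y : complex) (h : hom X Y).
Hypothesis inj_h : injective_hom h.
Implicit Types (t : tile X) (u : tile Y) (i j : label) (s : seq label).

Lemma hom_injective_tile t : injective (@vert X t) /\ injective (@side X t) ->
  injective (vert (hom_tile h t)) /\ injective (side (hom_tile h t)).
Proof.
have [inj_v inj_e _] := inj_h => -[inj_vt inj_et].
split=> i j; first by rewrite -!hom_vert => /inj_v/inj_vt.
by rewrite -!hom_side => /inj_e/inj_et.
Qed.

Hypothesis surj_h : forall u, exists t, hom_tile h t = u.

Lemma opposite_hom t i u j : opposite (hom_tile h t) i u j ->
  exists t', opposite t i t' j.
Proof.
have [inj_v inj_e inj_t] := inj_h; have [t' <-] := surj_h u.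
move=> [ne_t e_t [v1 v2] e_darts]; exists t'; split.
- by move=> eq_t; apply: ne_t; rewrite eq_t.
- by apply: inj_e; rewrite !hom_side.
- by split; apply: inj_v; rewrite !hom_vert.
- move=> t1 i1 eq_e; have := e_darts (hom_tile h t1) i1.
  rewrite -!hom_side eq_e => /(_ erefl)[] [/inj_t -> ->]; by [left|right].
Qed.

Lemma link_hom t i s : link (hom_tile h t) i s -> link t i s.
Proof.
have [inj_v inj_e inj_t] := inj_h.
move=> [n [c [n23 [inj_c all_v adj_c] c0 s_c]]]; exists n.
have [g gK] := choice surj_h.
exists (fun k => (g (c k).1, (c k).2)).
split=> //; last by rewrite c0 /= (inj_t _ _ (gK _)).
split.
- move=> k l [e1 e2]; apply: inj_c; rewrite [LHS]surjective_pairing e2.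
  by rewrite -[(c k).1]gK e1 gK -surjective_pairing.
- move=> t' i'; transitivity (vert (hom_tile h t') i' = vert (hom_tile h t) i).
    by rewrite -!hom_vert; split=> [->|/inj_v].
  rewrite all_v; split=> -[k c_k]; exists k.
    by rewrite c_k (inj_t _ _ (gK _)).
  by case: c_k => <- <-; rewrite gK -surjective_pairing.
- move=> k; have [ne_c e_c] := adj_c k; split=> /=.
    by move=> e; apply: ne_c; rewrite -[LHS]gK e gK.
  by apply: inj_e; rewrite !hom_side !gK.
Qed.

End Transport.

(** * The tiling as its own subdivision *)

Lemma omega_hom_inj X Y (h : hom X Y) :
  injective_hom h -> injective_hom (omega_hom h).
Proof.
move=> [inj_v inj_e inj_t]; split.
- by case=> [v|e|t i] [w|f|u j] // [] => [/inj_v->|/inj_e->|/inj_t-> ->].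
- by case=> [e v|t i|t i] [f w|u j|u j] // [] =>
    [/inj_e-> /inj_v->|/inj_t-> ->|/inj_t-> ->].
- by case=> [t|t i] [u|u j] // [] => [/inj_t->|/inj_t-> ->].
Qed.

Lemma Kn_incl_inj n : injective_hom (Kn_incl n).
Proof.
elim: n => [|n IHn]; last exact: omega_hom_inj.
by split=> [i j []|i j []|[] []].
Qed.

Section UnionTheory.
Variables (F : nat -> Type) (f : forall n, F n -> F n.+1).

Lemma union_inP (x : union f) : exists n (a : F n), x = union_in f a.
Proof.
case Dp: (repr x) => [n a]; exists n, a.
by rewrite /union_in -Dp; apply/esym/reprK.
Qed.

Lemma union_later d n (a : F n) :
  exists b : F (d + n), union_in f a = union_in f b.
Proof.
elim: d => [|d [b ->]]; first by exists a.
by exists (f b); rewrite union_in_next.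
Qed.

Lemma union_common (x y : union f) :
  exists n (a b : F n), x = union_in f a /\ y = union_in f b.
Proof.
have [n [a ->]] := union_inP x; have [m [b ->]] := union_inP y.
wlog le_nm: n m a b / (n <= m)%N.
  move=> IH; have [/IH//|/ltnW/IH IH'] := leqP n m.
  by have [l [b' [a' []]]] := IH' b a; exists l, a', b'.
have [a' ->] := union_later (m - n) a.
by rewrite subnK // in a' *; exists m, a', b.
Qed.

Section Lift.
Variables (T : Type) (h : forall n, F n -> T).
Arguments h {n} _.
Hypothesis hf : forall n (x : F n), h (f x) = h x.

(** The universal property of the union: a map out of it is a family [h] of
    maps compatible with [f]. *)
Definition union_lift (x : union f) : T := h (projT2 (repr x)).

Lemma union_lift_in n (x : F n) : union_lift (union_in f x) = h x.
Proof.
rewrite /union_lift; set p := repr _.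
have : \pi_{eq_quot eventually_eq f} p = union_in f x by rewrite reprK.
move=> /eqmodP/asboolP[k [l e]].
have hN m (q : stage F) : h (projT2 (iter m (next_stage f) q)) = h (projT2 q).
  by elim: m => //= m IHm; rewrite hf.
by rewrite -(hN k) e hN.
Qed.

Lemma union_lift_inj :
  (forall n, injective (@h n)) -> injective union_lift.
Proof.
move=> inj_h x y; have [n [a [b [-> ->]]]] := union_common x y.
by rewrite !union_lift_in => /inj_h->.
Qed.

End Lift.

(** Two elements of stage [n] that are identified have the same image after
    some numbers of steps; these numbers agree because the stages do, and each
    step is injective. *)
Lemma union_in_inj n :
  (forall m, injective (@f m)) -> injective (@union_in F f n).
Proof.
move=> inj_f x y /eqmodP/asboolP[k [l]].
have next_proj m (p : stage F) :
    projT1 (iter m (next_stage f) p) = (m + projT1 p)%N.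
  by elim: m => //= m ->.
move=> e; have:= congr1 (@projT1 _ _) e.
rewrite !next_proj => /addIn eq_kl; move: e; rewrite -{l}eq_kl.
have inj_next : injective (next_stage f).
  move=> [m a] [m' b] e; have:= congr1 (@projT1 _ _) e => -[/= eq_m].
  case: m' / eq_m b e => b e.
  by have /inj_f -> :=
    eq_from_Tagged (e : existT F m.+1 (f a) = existT F m.+1 (f b)).
elim: k => [|k IHk] e; first exact: eq_from_Tagged e.
exact/IHk/inj_next.
Qed.

End UnionTheory.

Lemma Kn_hom_inj n : injective_hom (Kn_hom n).
Proof.
by split; apply: union_in_inj => m; have [] := Kn_incl_inj m.
Qed.

Lemma Kn_injective_tiles n : injective_tiles (Kn n).
Proof.
elim: n => [|n IHn]; last exact: omega_injective_tiles.
by move=> t; split=> i j.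
Qed.

Lemma K_injective_tiles : injective_tiles K.
Proof.
move=> x; have [n [t ->]] := union_inP x.
by apply: (hom_injective_tile (Kn_hom_inj n)); apply: Kn_injective_tiles.
Qed.

(** Compatibility of the maps [Kn n.+1 = omega (Kn n) -> omega K] with the
    inclusions. *)
Lemma omega_Kn_vertex n (v : vertex (Kn n.+1)) :
  omega_vertex (Kn_hom n.+1) (hom_vertex (Kn_incl n.+1) v) =
  omega_vertex (Kn_hom n) v.
Proof. by case: v => [v|e|t i] /=; rewrite union_in_next. Qed.

Lemma omega_Kn_edge n (e : edge (Kn n.+1)) :
  omega_edge (Kn_hom n.+1) (hom_edge (Kn_incl n.+1) e) =
  omega_edge (Kn_hom n) e.
Proof. by case: e => [e v|t i|t i] /=; rewrite !union_in_next. Qed.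

Lemma omega_Kn_tile n (t : tile (Kn n.+1)) :
  omega_tile (Kn_hom n.+1) (hom_tile (Kn_incl n.+1) t) =
  omega_tile (Kn_hom n) t.
Proof. by case: t => [t|t i] /=; rewrite union_in_next. Qed.

(** At stage [n], first include [Kn n] into [Kn n.+1 = omega (Kn n)]: this also
    covers the stage 0, which is not a subdivision. *)
Definition desubdivide_vertex : vertex K -> vertex (omega K) :=
  union_lift (fun n v => omega_vertex (Kn_hom n) (hom_vertex (Kn_incl n) v)).
Definition desubdivide_edge : edge K -> edge (omega K) :=
  union_lift (fun n e => omega_edge (Kn_hom n) (hom_edge (Kn_incl n) e)).
Definition desubdivide_tile : tile K -> tile (omega K) :=
  union_lift (fun n t => omega_tile (Kn_hom n) (hom_tile (Kn_incl n) t)).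

Lemma desubdivide_vertex_in n v : desubdivide_vertex (hom_vertex (Kn_hom n) v) =
  omega_vertex (Kn_hom n) (hom_vertex (Kn_incl n) v).
Proof. by apply: union_lift_in => m x; rewrite omega_Kn_vertex. Qed.
Lemma desubdivide_edge_in n e : desubdivide_edge (hom_edge (Kn_hom n) e) =
  omega_edge (Kn_hom n) (hom_edge (Kn_incl n) e).
Proof. by apply: union_lift_in => m x; rewrite omega_Kn_edge. Qed.
Lemma desubdivide_tile_in n t : desubdivide_tile (hom_tile (Kn_hom n) t) =
  omega_tile (Kn_hom n) (hom_tile (Kn_incl n) t).
Proof. by apply: union_lift_in => m x; rewrite omega_Kn_tile. Qed.

Lemma desubdivide_vertP (t : tile K) i :
  desubdivide_vertex (vert t i) = vert (desubdivide_tile t) i.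
Proof.
have [n [s ->]] := union_inP t; rewrite K_vert.
rewrite desubdivide_vertex_in desubdivide_tile_in.
by rewrite hom_vert; apply: omega_vertP.
Qed.

Lemma desubdivide_sideP (t : tile K) i :
  desubdivide_edge (side t i) = side (desubdivide_tile t) i.
Proof.
have [n [s ->]] := union_inP t; rewrite K_side.
rewrite desubdivide_edge_in desubdivide_tile_in.
by rewrite hom_side; apply: omega_sideP.
Qed.

Definition desubdivide : hom K (omega K) :=
  Hom desubdivide_vertP desubdivide_sideP.

Lemma desubdivide_inj : injective_hom desubdivide.
Proof.
split.
- apply: union_lift_inj => [n x|n x y]; first exact: omega_Kn_vertex.
  have [inj_v _ _] := omega_hom_inj (Kn_hom_inj n).
  by move=> /inj_v; have [inj_v' _ _] := Kn_incl_inj n => /inj_v'.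
- apply: union_lift_inj => [n x|n x y]; first exact: omega_Kn_edge.
  have [_ inj_e _] := omega_hom_inj (Kn_hom_inj n).
  by move=> /inj_e; have [_ inj_e' _] := Kn_incl_inj n => /inj_e'.
- apply: union_lift_inj => [n x|n x y]; first exact: omega_Kn_tile.
  have [_ _ inj_t] := omega_hom_inj (Kn_hom_inj n).
  by move=> /inj_t; have [_ _ inj_t'] := Kn_incl_inj n => /inj_t'.
Qed.

Lemma desubdivide_next n (s : tile (Kn n.+1)) :
  desubdivide_tile (hom_tile (Kn_hom n.+1) s) = omega_tile (Kn_hom n) s.
Proof. by rewrite desubdivide_tile_in omega_Kn_tile. Qed.

Lemma desubdivide_surj (s : tile (omega K)) : exists t, desubdivide_tile t = s.
Proof.
case: s => [x|x i]; have [n [t ->]] := union_inP x.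
  by exists (hom_tile (Kn_hom n.+1) (center t)); rewrite desubdivide_next.
by exists (hom_tile (Kn_hom n.+1) (corner t i)); rewrite desubdivide_next.
Qed.

(** From a tile of stage [n], a center is reached after at most [n] passages to
    the parent, since the tile of stage 0 is identified with the center of
    stage 1. *)
Lemma K_tile_ind (P : tile K -> Prop) :
    (forall t t', desubdivide_tile t = center t' -> P t) ->
    (forall t t' i, desubdivide_tile t = corner t' i -> P t' -> P t) ->
  forall t, P t.
Proof.
move=> Pcenter Pcorner x; have [n [t ->]] := union_inP x => {x}.
elim: n t => [|n IHn] t.
  apply: (Pcenter _ (hom_tile (Kn_hom 0) tt)).
  by rewrite (desubdivide_tile_in (n := 0)).
have:= desubdivide_next t; case: t => [t|t i] def_t; first exact: Pcenter def_t.
exact: Pcorner def_t (IHn t).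
Qed.
(** * Codes and collared types *)

(** Each label is at the position of its representative in 0, ..., 4. *)
Definition labels : seq label := [:: 0; 1; 2; 3; 4].

Lemma labelsE (i : label) : labels`_i = i.
Proof. by case: i => [[|[|[|[|[|]]]]] //= ?]; apply: val_inj. Qed.

Lemma mem_labels i : i \in labels.
Proof. by rewrite -[i]labelsE mem_nth. Qed.

Definition link_at (c : seq (seq label)) (i : label) : seq label :=
  nth [::] c i.

Definition code_of (f : label -> seq label) : seq (seq label) := map f labels.

Lemma link_at_code f i : link_at (code_of f) i = f i.
Proof. by rewrite /link_at (nth_map 0) ?labelsE. Qed.

(** Around [c_i]: the center, the corner [i], the corner [i + 1]. *)
Definition center_code := code_of (fun i => [:: i; i + 2; i - 1]).

(** [j] and [j'] are the numbers, in the tiles across them, of the edges [i]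
    and [i - 1] of a tile with code [c]; the entries are those of
    [old_link], [midpoint_link], [inner_link], [next_inner_link] and again
    [midpoint_link]. *)
Definition corner_code (c : seq (seq label)) (i : label) :=
  let j := (link_at c (i + 1))`_1 in
  let j' := (link_at c i)`_1 in
  code_of (from i (link_at c i) [:: i + 1; j; j + 1; i] [:: i + 2; i - 1; i]
                [:: i - 2; i - 1; i + 1] [:: i - 1; i; j'; j' + 1]).

Definition step cs :=
  undup (cs ++ [seq corner_code c i | c <- cs, i <- labels]).
(** After three rounds the closure is complete. *)
Definition codes := iter 3 step [:: center_code].

(** The two labels on the edge [i] in [N_i] are consecutive; the label of the
    vertex [i + 1] in [N_i] comes second in its link, and the one in the tile
    opposite to [t] there comes third, if the degree is 4. *)
Definition block_at c (i : label) : block :=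
  let s := link_at c (i + 1) in
  (num (s`_1 + 1), num s`_1, if size s == 4 then num s`_2 else 0%N).

Definition blocks c : 5.-tuple block :=
 [tuple block_at c 1; block_at c 2; block_at c 3; block_at c 4; block_at c 0].

Lemma tnth_blocks c (k : 'I_5) : tnth (blocks c) k = block_at c k.+1%:R.
Proof.
rewrite (tnth_nth (0, 0, 0)%N); case: k => [[|[|[|[|[|//]]]]] lt_k] //=.
Qed.

Definition quad_of s : quad :=
  if size s == 4 then (num s`_0, num s`_1, num s`_2, num s`_3)
  else (num s`_0, 0%N, num s`_1, num s`_2).

(** The link of the vertex [i + 1] is rotated so as to start from the tile
    across the edge [i]. *)
Definition edge_quads c (i : label) : quad * quad :=
  (quad_of (link_at c i), quad_of (rot 1 (link_at c (i + 1)))).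

Definition edge_types C := [seq edge_quads c i | c <- C, i <- labels].

(** Each vertex yields all the rotations of its cyclic sequence, one for each
    tile around it. *)
Definition vertex_types C := [seq quad_of (link_at c i) | c <- C, i <- labels].

Definition tile_code X (t : tile X) (c : seq (seq label)) : Prop :=
  forall i, link t i (link_at c i).

(** * Collared objects of a complex without boundary *)

Section LinkTheory.
Variable X : complex.
Hypothesis inj_X : injective_tiles X.
Hypothesis opp_X : forall (t : tile X) i, exists u j, opposite t i u j.
Implicit Types (t u : tile X) (i j : label) (s : seq label).

Lemma opposite_unique t i u j u' j' :
  opposite t i u j -> u' <> t -> side u' j' = side t i -> (u', j') = (u, j).
Proof. by move=> [_ _ _ e_darts] ne_t /e_darts[] // [/ne_t]. Qed.

(** As [opposite] is functional, each step clockwise around a vertex is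
    determined. *)
Lemma around_unique v n (c c' : 'I_n.+1 -> tile X * label) :
  clockwise_around v c -> clockwise_around v c' -> c ord0 = c' ord0 -> c =1 c'.
Proof.
move=> [_ _ adj_c] [_ _ adj_c'] eq0 k.
have [m] : exists m, k = m :> nat by exists k.
elim: m k => [|m IHm] k def_k.
  by rewrite (_ : k = ord0) //; apply: val_inj.
have lt_m : (m < n.+1)%N by rewrite ltnW // -def_k.
have -> : k = ordS (Ordinal lt_m).
  by apply: val_inj; rewrite /= modn_small -?def_k.
have [ne_c e_c] := adj_c (Ordinal lt_m).
have := adj_c' (Ordinal lt_m).
rewrite -(IHm (Ordinal lt_m)) // => -[ne_c' e_c'].
have [u [j opp_c]] := opp_X (c (Ordinal lt_m)).1 ((c (Ordinal lt_m)).2 - 1).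
rewrite [LHS]surjective_pairing [RHS]surjective_pairing.
by rewrite (opposite_unique opp_c ne_c e_c) (opposite_unique opp_c ne_c' e_c').
Qed.

Lemma around_tile_inj v n (c : 'I_n.+1 -> tile X * label) k l :
  clockwise_around v c -> (c k).1 = (c l).1 -> k = l.
Proof.
move=> [inj_c all_v _] e; apply: inj_c.
have v_c m : vert (c m).1 (c m).2 = v by apply/all_v; exists m; case: (c m).
rewrite [LHS]surjective_pairing [RHS]surjective_pairing.
have [inj_v _] := inj_X (c k).1.
by rewrite -e; congr pair; apply: inj_v; rewrite v_c e v_c.
Qed.

(** The edges at [v] are the sides that start at [v], one for each tile around
    [v], because the side that ends at [v] in a tile starts at [v] in the next
    one. They are distinct: an edge has only two darts, so two tiles around [v]
    with the same starting side would be consecutive, and then the first of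
    them would have this edge on both sides of [v]. *)
Lemma around_degree v n (c : 'I_n.+1 -> tile X * label) :
  (1 < n)%N -> clockwise_around v c -> degree v n.+1.
Proof.
move=> n_gt1 ar_c; have [inj_c all_v adj_c] := ar_c.
have v_c k : vert (c k).1 (c k).2 = v by apply/all_v; exists k; case: (c k).
pose f k := side (c (inord k)).1 (c (inord k)).2.
have f_ord (k : 'I_n.+1) : f k = side (c k).1 (c k).2.
  by rewrite /f inord_val.
have inj_tile k l := around_tile_inj (k := k) (l := l) ar_c.
have inj_side k l : side (c k).1 (c k).2 = side (c l).1 (c l).2 -> k = l.
  move=> e; apply/eqP; apply: contraT => /eqP ne_kl.
  have ne_t k' l' : k' <> l' -> (c k').1 <> (c l').1 by move=> ne /inj_tile.
  have [m def_m] : exists m, ordS m = l.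
    by exists (ord_pred l); rewrite ord_predK.
  have [ne_m e_m] := adj_c m; rewrite def_m in ne_m e_m.
  have [u [j opp_m]] := opp_X (c m).1 ((c m).2 - 1).
  have eq_l := opposite_unique opp_m ne_m e_m.
  have [eq_km|ne_km] := eqVneq k m.
    rewrite eq_km e_m in e; have [_ inj_e] := inj_X (c m).1.
    by have /esym/label_neqP := inj_e _ _ e.
  have ne_m' : (c k).1 <> (c m).1 by apply: ne_t; apply/eqP.
  rewrite e_m in e; have := opposite_unique opp_m ne_m' e.
  by rewrite -eq_l => -[/inj_tile/ne_kl].
have -> : degree v n.+1 = ((f @` `I_n.+1)%classic #= `I_n.+1)%card.
  congr (_ #= _)%card; apply/seteqP; split=> e.
    move=> [t [i [<- v_t]]].
    have [[k c_k]|[k c_k]] :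
        (exists k, c k = (t, i)) \/ (exists k, c k = (t, i + 1)).
      by case: v_t => /all_v; [left|right].
    + by exists k; [exact: ltn_ord|rewrite f_ord c_k].
    + exists (ordS k); [exact: ltn_ord|rewrite f_ord].
      by have [_ ->] := adj_c k; rewrite c_k addrK.
  move=> [k /= lt_k <-]; exists (c (inord k)).1, (c (inord k)).2.
  by split=> //; left; apply: v_c.
apply: inj_card_eq => k l; rewrite !inE /= => lt_k lt_l /inj_side e.
by rewrite -(inordK lt_k) e inordK.
Qed.

Lemma link_degree t i s : link t i s -> degree (vert t i) (size s).
Proof.
move=> [n [c [n23 ar_c _ ->]]]; rewrite size_mkseq.
by apply: around_degree ar_c; case: n23 => ->.
Qed.

(** Turning clockwise around the vertex [i + 1] of [t], the tile after [t] is
    the one across the edge [i]. *)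
Lemma link_rot t i s u j : link t (i + 1) s -> opposite t i u j ->
  s`_1 = j /\ link u j (rot 1 s).
Proof.
move=> [n [c [n23 ar_c c0 ->]]] opp_t; have [inj_c all_v adj_c] := ar_c.
have c1 : c (ordS ord0) = (u, j).
  have [ne_c e_c] := adj_c ord0; rewrite c0 /= addrK in ne_c e_c.
  by rewrite [LHS]surjective_pairing (opposite_unique opp_t ne_c e_c).
have S0 : inord 1 = ordS ord0 :> 'I_n.+1.
  by apply: val_inj; case: n23 => ->; rewrite /= inordK.
split; first by rewrite nth_mkseq ?S0 ?c1 //; case: n23 => ->.
exists n, (c \o @ordS n.+1); split=> //=.
- have -> : vert u j = vert t (i + 1) by case: opp_t => _ _ [].
  split=> [||k]; last exact: adj_c.
    by move=> k l /inj_c /(can_inj (@ordSK _)).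
  move=> t' i'; rewrite all_v; split=> -[k ck]; last by exists (ordS k).
  by exists (ord_pred k); rewrite /= ord_predK.
- case: n23 => ?; subst n.
    rewrite /mkseq /=; congr [:: (c _).2; (c _).2; (c _).2];
      by apply: val_inj; rewrite /= !inordK.
  rewrite /mkseq /=; congr [:: (c _).2; (c _).2; (c _).2; (c _).2];
    by apply: val_inj; rewrite /= !inordK.
Qed.

Lemma degree_inj (v : vertex X) m n : degree v m -> degree v n -> m = n.
Proof.
move=> deg_m deg_n; apply/card_eq_II.
by apply: card_eq_trans deg_n; rewrite card_eq_sym.
Qed.

Lemma neighbour_opposite t i u : neighbour t i u -> exists j, opposite t i u j.
Proof.
move=> [ne_ut [j e_ut]]; have [u' [j' opp_t]] := opp_X t i.
by have [-> _] := opposite_unique opp_t ne_ut e_ut; exists j'.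
Qed.

(** The tiles around a vertex of degree 4 are, clockwise, [t], [N i], the fourth
    tile and [N (i + 1)]; they are distinct since no tile touches itself. *)
Lemma fourth_tileP t i s (N : label -> tile X) r :
    link t (i + 1) s -> size s = 4%N ->
    neighbour t i (N i) -> neighbour t (i + 1) (N (i + 1)) ->
  (exists u j, [/\ u <> t, u <> N i, u <> N (i + 1),
                  vert u j = vert t (i + 1) & r = num j]) <-> r = num s`_2.
Proof.
move=> link_s size_s.
move=> /neighbour_opposite[j opp_i] /neighbour_opposite[j' opp_i'].
have [n [c [_ ar_c c0 def_s]]] := link_s.
have ? : n = 3%N by move: size_s; rewrite def_s size_mkseq => -[].
subst n; have inj_tile k l := around_tile_inj (k := k) (l := l) ar_c.
have [inj_c all_v adj_c] := ar_c.
have c1 : (c (inord 1)).1 = N i.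
  have [ne_c e_c] := adj_c ord0; rewrite c0 /= addrK in ne_c e_c.
  have := opposite_unique opp_i ne_c e_c.
  rewrite (_ : ordS ord0 = inord 1) => [[]//|].
  by apply: val_inj; rewrite /= inordK.
have c3 : (c (inord 3)).1 = N (i + 1).
  have [ne_c e_c] := adj_c (inord 3).
  have S3 : ordS (inord 3) = ord0 :> 'I_4 by apply: val_inj; rewrite /= inordK.
  rewrite S3 c0 /= in ne_c e_c.
  by have [] := opposite_unique opp_i' (nesym ne_c) (esym e_c).
have c0t : (c ord0).1 = t by rewrite c0.
rewrite def_s /=; split=> [[u [k [ne_t ne_i ne_i' /all_v[l c_l] ->]]]|->].
  suff -> : inord 2 = l by rewrite c_l.
  apply: val_inj; rewrite /= inordK //.
  have {}c_l : (c l).1 = u by rewrite c_l.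
  case: l c_l => [[|[|[|[|//]]]] lt_l] //= c_l; exfalso.
  - by apply: ne_t; rewrite -c_l -c0t; congr (c _).1; apply: val_inj.
  - by apply: ne_i; rewrite -c_l -c1; congr (c _).1;
      apply: val_inj; rewrite /= inordK.
  - by apply: ne_i'; rewrite -c_l -c3; congr (c _).1;
      apply: val_inj; rewrite /= inordK.
exists (c (inord 2)).1, (c (inord 2)).2; split=> //.
- by rewrite -c0t => /inj_tile/(congr1 val); rewrite /= inordK.
- by rewrite -c1 => /inj_tile/(congr1 val); rewrite /= !inordK.
- by rewrite -c3 => /inj_tile/(congr1 val); rewrite /= !inordK.
- by apply/all_v; exists (inord 2); case: (c _).
Qed.

Lemma collared_blockP t c N i b : tile_code t c ->
    (forall i, neighbour t i (N i)) ->
  collared_block t N i b <-> b = block_at c i.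
Proof.
move=> code_c nb_N; have link_s := code_c (i + 1).
case: b => [[p q] r]; rewrite /collared_block /block_at.
have [j opp_i] := neighbour_opposite (nb_N i).
have [-> _] := link_rot link_s opp_i.
have [inj_v _] := inj_X (N i); have [_ _ [v_j v_Sj] _] := opp_i.
have deg_s := link_degree link_s.
have deg3 : degree (vert t (i + 1)) 3 <-> size (link_at c (i + 1)) = 3%N.
  by split=> [/(degree_inj deg_s)|e]; last by rewrite e in deg_s.
have deg4 : degree (vert t (i + 1)) 4 <-> size (link_at c (i + 1)) = 4%N.
  by split=> [/(degree_inj deg_s)|e]; last by rewrite e in deg_s.
split.
  move=> [[j1 v1 ->] [j2 v2 ->] r_P]; rewrite -v_Sj in v1; rewrite -v_j in v2.
  rewrite (inj_v _ _ v1) (inj_v _ _ v2); congr (_, _, _).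
  case: r_P => -[]; first by move/deg3 => ->.
  move/deg4 => s4 /(fourth_tileP _ link_s s4 (nb_N _) (nb_N _)) ->.
  by rewrite s4.
move=> [-> -> ->]; split; [by exists (j + 1)|by exists j|].
have [n [d [n23 _ _ def_s]]] := link_s; have := congr1 size def_s.
rewrite size_mkseq; case: n23 => -> s34; [left|right]; split.
- exact/deg3.
- by rewrite s34.
- exact/deg4.
- by apply/(fourth_tileP _ link_s s34 (nb_N _) (nb_N _)); rewrite s34.
Qed.

Lemma collared_tileP t c b :
  tile_code t c -> collared_tile t b <-> b = blocks c.
Proof.
move=> code_c; split=> [[N [nb_N b_P]]|->].
  apply: eq_from_tnth => k; rewrite tnth_blocks.
  exact/(collared_blockP _ _ code_c nb_N).
have [N nb_N] : {N : label -> tile X & forall i, neighbour t i (N i)}.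
  apply: choice => i; have [u [j [ne_ut e_ut _ _]]] := opp_X t i.
  by exists u; split=> //; exists j.
exists N; split=> // k; rewrite tnth_blocks.
exact/(collared_blockP _ _ code_c nb_N).
Qed.

(** The tile [A] fixes where the cyclic sequence starts, and the degree excludes
    the other format. *)
Lemma quad_fromP t i s q :
  link t i s -> quad_from (vert t i) t q <-> q = quad_of s.
Proof.
move=> link_s; have deg_s := link_degree link_s.
have [n [c [n23 ar_c c0 def_s]]] := link_s.
have uniq_c (c' : 'I_n.+1 -> tile X * label) :
    clockwise_around (vert t i) c' -> (c' ord0).1 = t -> c' =1 c.
  move=> ar_c' c'0; apply: (around_unique ar_c' ar_c).
  rewrite c0 [LHS]surjective_pairing c'0; congr pair.
  have [inj_v _] := inj_X t; apply: inj_v; have [_ all_v _] := ar_c'.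
  by apply/all_v; exists ord0; rewrite -[in RHS]c'0 -surjective_pairing.
rewrite /quad_of /quad_from def_s; split.
  case=> -[deg_q [c' /= [ar_c' c'0 def_q]]]; rewrite {}def_q;
    have eq_n := degree_inj deg_s deg_q; rewrite def_s size_mkseq in eq_n.
    case: eq_n => ?; subst n.
    have {}uniq_c := uniq_c _ ar_c' c'0.
    by rewrite /= !uniq_c.
  case: eq_n => ?; subst n; have {}uniq_c := uniq_c _ ar_c' c'0.
  by rewrite /= !uniq_c.
rewrite size_mkseq => ->; rewrite def_s size_mkseq in deg_s.
by case: n23 => ?; subst n; [right|left]; split=> //; exists c; rewrite c0.
Qed.

Variable C : seq (seq (seq label)).
Hypothesis coded : forall t, exists2 c, c \in C & tile_code t c.
Hypothesis realized : forall c, c \in C -> exists t, tile_code t c.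

Lemma collared_tile_types b :
  (exists t, collared_tile t b) <-> b \in map blocks C.
Proof.
split=> [[t]|/mapP[c /realized[t code_c] ->]].
  have [c C_c code_c] := coded t.
  by move/(collared_tileP _ code_c) => ->; apply: map_f.
by exists t; apply/(collared_tileP _ code_c).
Qed.

Lemma collared_edge_types q :
  (exists e : edge X, collared_edge e q) <-> q \in edge_types C.
Proof.
split=> [|/allpairsP[[c i] /= [/realized[t code_c] _ ->]]].
  move=> [e [A [B [i [j [v [w [[ne_AB eA eB] H]]]]]]]].
  move: H => [[vA wA wB vB] [q1_P q2_P]].
  have [c C_c code_c] := coded A.
  have opp_A : opposite A i B j.
    have [u [k opp_A]] := opp_X A i.
    have e_AB : side B j = side A i by rewrite eA eB.
    by case: (opposite_unique opp_A (nesym ne_AB) e_AB) => -> ->.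
  have [_ link_B] := link_rot (code_c (i + 1)) opp_A.
  suff -> : q = edge_quads c i by apply: allpairs_f => //; apply: mem_labels.
  rewrite -vA in q1_P; rewrite -wB in q2_P; rewrite [LHS]surjective_pairing.
  congr pair; first exact/(quad_fromP _ (code_c i)).
  exact/(quad_fromP _ link_B).
have [u [j opp_t]] := opp_X t i; have [ne_t e_t [v1 v2] _] := opp_t.
have [_ link_u] := link_rot (code_c (i + 1)) opp_t.
exists (side t i), t, u, i, j, (vert t i), (vert t (i + 1)).
split; first by split=> // /esym.
do 2!split=> //; first exact/(quad_fromP _ (code_c i)).
by rewrite -v1; apply/(quad_fromP _ link_u).
Qed.

Lemma collared_vertex_types q :
  (exists v : vertex X, collared_vertex v q) <->
  smallest_first q && (q \in vertex_types C).
Proof.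
split=> [[v [min_q [t q_P]]]|].
  have [i v_i] : exists i, vert t i = v.
    case: q_P => -[_ [c /= [[_ all_v _] <- _]]]; exists (c ord0).2;
      by apply/all_v; exists ord0; case: (c _).
  have [c C_c code_c] := coded t; rewrite min_q -v_i in q_P *.
  have /(_ q_P) -> := proj1 (quad_fromP q (code_c i)).
  by apply: allpairs_f => //; apply: mem_labels.
move=> /andP[min_q /allpairsP[[c i] /= [/realized[t code_c] _ def_q]]].
by exists (vert t i); split=> //; exists t; apply/(quad_fromP _ (code_c i)).
Qed.

End LinkTheory.

(** * The codes of the tiling *)

Section OmegaCode.
Variable X : complex.

Lemma center_tile_code (t : tile X) :
  tile_code (center t : tile (omega X)) center_code.
Proof. by move=> i; rewrite link_at_code; apply: center_link. Qed.

Hypothesis opp_X : forall (t : tile X) i, exists u j, opposite t i u j.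

Lemma corner_tile_code (t : tile X) c i :
  tile_code t c -> tile_code (corner t i : tile (omega X)) (corner_code c i).
Proof.
move=> code_c k; rewrite link_at_code.
have [u [j opp_i]] := opp_X t i; have [u' [j' opp_i']] := opp_X t (i - 1).
have [-> _] := link_rot (code_c (i + 1)) opp_i.
have := code_c i; rewrite -{1}[i](subrK 1).
move=> /link_rot/(_ opp_i')[-> _].
elim/(label_ind i): k; rewrite fromE.
- exact/old_link.
- by have [] := midpoint_link opp_i.
- exact: inner_link.
- by have := next_inner_link t (i - 1); rewrite subrK label_sub1P label_sub1A2.
- by have [_] := midpoint_link opp_i'; rewrite subrK.
Qed.
End OmegaCode.

Lemma tile_code_hom X Y (h : hom X Y) t c : injective_hom h ->
  (forall u, exists t, hom_tile h t = u) ->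
  tile_code (hom_tile h t) c -> tile_code t c.
Proof. by move=> inj_h surj_h code_c i; apply/(link_hom inj_h surj_h). Qed.

Lemma K_opposite (t : tile K) i : exists u j, opposite t i u j.
Proof.
move: i; elim/K_tile_ind: t => [t t' def_t|t t' k def_t opp_t'] i.
  have := ring_opposite t' i; rewrite -def_t.
  move/(opposite_hom desubdivide_inj desubdivide_surj) => [u opp_t].
  by exists u, (i - 2).
have [u [j]] := omega_opposite K_injective_tiles opp_t' k i; rewrite -def_t.
move/(opposite_hom desubdivide_inj desubdivide_surj) => [u' opp_t].
by exists u', j.
Qed.

Lemma codes_closed c i : c \in codes -> corner_code c i \in codes.
Proof.
have closed :
    all (fun c => all (fun i => corner_code c i \in codes) labels) codes.
  by vm_compute.
by move=> /(allP closed)/allP; apply; apply: mem_labels.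
Qed.

Lemma K_code (t : tile K) : exists2 c, c \in codes & tile_code t c.
Proof.
elim/K_tile_ind: t => [t t' def_t|t t' i def_t [c codes_c code_c]].
  exists center_code => //.
  apply: (tile_code_hom desubdivide_inj desubdivide_surj).
  by rewrite [hom_tile _ _]def_t; apply: center_tile_code.
exists (corner_code c i); first exact: codes_closed.
apply: (tile_code_hom desubdivide_inj desubdivide_surj).
rewrite [hom_tile _ _]def_t.
exact: (corner_tile_code K_opposite i code_c).
Qed.

Lemma codes_K c : c \in codes -> exists t : tile K, tile_code t c.
Proof.
suff gen n : forall c, c \in iter n step [:: center_code] ->
    exists t : tile K, tile_code t c by exact: gen.
elim: n => [|n IHn] {}c.
  rewrite inE => /eqP ->.
  have [t def_t] := desubdivide_surj (center (hom_tile (Kn_hom 0) tt)).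
  exists t; apply: (tile_code_hom desubdivide_inj desubdivide_surj).
  by rewrite [hom_tile _ _]def_t; apply: center_tile_code.
rewrite iterS mem_undup mem_cat => /orP[/IHn//|].
move=> /allpairsP[[d i] /= [/IHn[t code_d] _ ->]].
have [t' def_t'] := desubdivide_surj (corner t i); exists t'.
apply: (tile_code_hom desubdivide_inj desubdivide_surj).
rewrite [hom_tile _ _]def_t'.
exact: (corner_tile_code K_opposite i code_d).
Qed.

Theorem theorem1p4 :
  [/\ forall b : 5.-tuple block,
        (exists t : tile K, collared_tile t b) <-> b \in collared_tiles,
      forall q : quad * quad,
        (exists e : edge K, collared_edge e q) <->
        (exists2 q', q' \in collared_edges & edge_equiv q q')
    & forall q : quad,
        (exists v : vertex K, collared_vertex v q) <->
        q \in collared_vertices].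
Proof.
have tilesE : perm_eq (map blocks codes) collared_tiles by vm_compute.
have edges_sound : all (fun q => has (edge_equiv q) collared_edges)
    (edge_types codes) by vm_compute.
(* Each edge is seen from both of its tiles, hence in both orders. *)
have edges_complete : all (mem (edge_types codes))
    (collared_edges ++ [seq (q.2, q.1) | q <- collared_edges]) by vm_compute.
have verticesE : perm_eq (undup (filter smallest_first (vertex_types codes)))
    collared_vertices by vm_compute.
(* The rest holds for any list [C] of the codes that occur in [K]. *)
move: codes K_code codes_K tilesE edges_sound edges_complete verticesE.
move=> C coded realized tilesE edges_sound edges_complete verticesE.
split=> [b|q|q].
- rewrite (collared_tile_types K_injective_tiles K_opposite coded realized).
  by rewrite (perm_mem tilesE).
- rewrite (collared_edge_types K_injective_tiles K_opposite coded realized).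
  split=> [/(allP edges_sound)/hasP//|[q' q'_in eqv]].
  apply: (allP edges_complete).
  by rewrite mem_cat; case/orP: eqv => /eqP ->; rewrite ?q'_in ?map_f ?orbT.
- rewrite (collared_vertex_types K_injective_tiles K_opposite coded realized).
  by rewrite -(perm_mem verticesE) mem_undup mem_filter.
Qed.
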